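(* Let $n\ge 2$ be an integer. Let $d$ be the odd divisor of $n(n+1)$ which is different from $n$ and $n+1$ and minimizes $$\left| d-\frac{n(n+1)}{d}\right|,$$ and let $e=n(n+1)/d$. Then $$\Xi(n)=\frac{\max(d,e)-\min(d,e)-1}{2}.$$
   Context: $T_j=j(j+1)/2$ denotes the $j$-th triangular number. For $n\ge 2$, $\Xi(n)$ denotes the smallest integer $k>0$ such that $T_n+T_k=T_m$ for some integer $m$ (such a $k$ always exists). *)

(* Defs.v *)
From mathcomp Require Import all_boot all_order all_algebra.
From mathcomp Require Import boolp.
From mathcomp Require Import zify ring.
Set Implicit Arguments.
Unset Strict Implicit.
Unset Printing Implicit Defensive.
Import Order.TTheory GRing.Theory Num.Theory.
Local Open Scope ring_scope.

(* Indexed by all integers, since the index m in the definition of Xi is only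
   required to be an integer. The division is exact. *)
Definition tri (j : int) : int := (j * (j + 1) %/ 2)%Z.

Definition sum_triangular (n k : nat) : Prop :=
  (0 < k)%N /\ exists m : int, tri n%:Z + tri k%:Z = tri m.

Lemma sum_triangular_ex (n : nat) (hn : (2 <= n)%N) :
  exists k : nat, `[< sum_triangular n k >].
Proof.
pose t := ((n * n.+1) %/ 2)%N.
have Tnat (j : nat) : tri j%:Z = ((j * j.+1) %/ 2)%N%:Z by rewrite /tri; lia.
have ht : (3 <= t)%N by rewrite /t; nia.
exists t.-1; apply/asboolP; split; first by lia.
exists t%:Z; rewrite !Tnat -/t.
rewrite -PoszD; congr Posz.
case: (t) ht => // u _; rewrite [u.+1.-1]/= [in RHS]mulnC.
have -> : (u.+2 * u.+1 = u.+1 * 2 + u * u.+1)%N by ring.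
by rewrite divnMDl.
Qed.

(* The condition 2 <= n is an argument because for n = 1 no such k exists. *)
Definition Xi (n : nat) (hn : (2 <= n)%N) : nat :=
  ex_minn (sum_triangular_ex hn).

Definition admissible (n d : nat) : Prop :=
  [/\ odd d, (d %| n * (n + 1))%N, d <> n & d <> (n + 1)%N].

Definition gap (n d : nat) : int :=
  `| d%:Z - ((n * (n + 1)) %/ d)%N%:Z |.

Definition is_closest (n d : nat) : Prop :=
  admissible n d /\ forall d' : nat, admissible n d' -> gap n d <= gap n d'.

Lemma is_closest_unique (n : nat) :
  (2 <= n)%N -> exists! d : nat, is_closest n d.
Proof.
move=> hn.
have ex : exists g : nat, `[< exists2 d, admissible n d & gap n d = g%:Z >].
  exists `|gap n 1|%N; apply/asboolP; exists 1%N; last by rewrite gez0_abs.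
  by split=> //; lia.
case: (ex_minnP ex) => g /asboolP[d dP dg] dmin.
have dle d' : admissible n d' -> gap n d <= gap n d'.
  move=> d'P; rewrite dg -[gap n d']gez0_abs // lez_nat; apply: dmin.
  by apply/asboolP; exists d'; rewrite // gez0_abs.
exists d; split=> // d' [d'P d'min].
have gE : gap n d = gap n d' by apply/eqP; rewrite eq_le dle //= d'min.
case: dP d'P => od /divnK dE _ _ [od' /divnK d'E _ _].
move: gE; rewrite /gap.
set e := ((n * (n + 1)) %/ d)%N in dE *.
set e' := ((n * (n + 1)) %/ d')%N in d'E *.
have ev : ~~ odd (n * (n + 1)) by rewrite oddM oddD; case: (odd n).
have ee' : ~~ odd e' by move: ev; rewrite -d'E oddM od' andbT.
have pE : e%:Z * d%:Z = e'%:Z * d'%:Z by rewrite -!PoszM dE d'E.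
move=> /(congr1 (fun x => x ^+ 2)); rewrite !real_normK ?num_real // => sE.
have fE : (d + e)%:Z ^+ 2 = (d' + e')%:Z ^+ 2.
  rewrite !PoszD.
  transitivity ((d%:Z - e%:Z) ^+ 2 + 4 * (e%:Z * d%:Z)); first by ring.
  by rewrite sE pE; ring.
move/eqP: fE; rewrite eqrXn2 // => /eqP[h].
have : (d%:Z - d'%:Z) * (d%:Z - e'%:Z) = 0.
  have eE : e%:Z = d'%:Z + e'%:Z - d%:Z by lia.
  move: pE; rewrite eE => pE.
  transitivity (e'%:Z * d'%:Z - (d'%:Z + e'%:Z - d%:Z) * d%:Z); first by ring.
  by rewrite pE subrr.
move/eqP; rewrite mulf_eq0 !subr_eq0 => /orP[/eqP[] //|/eqP[de']].
by move: od; rewrite de' (negPf ee').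
Qed.

(* Main.v *)
Require Import Defs.
From mathcomp Require Import all_boot all_order all_algebra.
From mathcomp Require Import zify ring.
Import Order.TTheory GRing.Theory Num.Theory.
Local Open Scope ring_scope.

(** The equation [T_n + T_k = T_m] says [n (n + 1) = (m - k) (m + k + 1)]:
    its solutions are the factorizations of [n (n + 1)] into two factors that
    differ by [2 k + 1] ([sum_triangular_factor]).  Such factors have opposite
    parity, and since [n (n + 1)] is even, a factorization into factors of
    opposite parity is the same thing as an odd divisor [d].  The condition
    [k > 0] excludes exactly the factorization [n * (n + 1)], whose factors
    differ by [1]; this is the condition [d <> n, n + 1].  Thus the values
    [2 k + 1] for the admitted [k] are exactly the values of [gap n d] for
    admissible [d] ([sum_triangular_gap]), and the least [k] comes from the [d]
    of least gap. *)

Lemma tri_double (j : int) : 2 * tri j = j * (j + 1).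
Proof.
rewrite /tri; have : (2 %| j * (j + 1))%Z by rewrite dvdzE abszM Euclid_dvdM //; lia.
by move/divzK; rewrite mulrC.
Qed.

Lemma sum_triangular_factor (n k : nat) :
  sum_triangular n k <->
  (0 < k)%N /\ exists a : nat, (a * (a + 2 * k + 1) = n * (n + 1))%N.
Proof.
split=> -[k_gt0].
- case=> m0 E0; split=> //.
  (* [T_m = T_(-m-1)], so the index may be taken to be a natural number. *)
  have [m Em] : exists m : nat, (m * (m + 1) = n * (n + 1) + k * (k + 1))%N.
    have E : m0 * (m0 + 1) = n%:Z * (n%:Z + 1) + k%:Z * (k%:Z + 1).
      by rewrite -!tri_double -E0 mulrDr.
    case: m0 E0 E => p _ E; exists p; first by lia.
    rewrite NegzE in E; apply/eqP; rewrite -eqz_nat !(PoszD, PoszM) -E.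
    by apply/eqP; rewrite -addn1 PoszD; ring.
  have le_km : (k <= m)%N by nia.
  exists (m - k)%N; move: Em; rewrite -{1 2}(subnK le_km).
  by move: (m - k)%N => a; lia.
- case=> a Ea; split=> //; exists (a + k)%N%:Z.
  have : 2 * (tri n%:Z + tri k%:Z) = 2 * tri (a + k)%N%:Z.
    by rewrite mulrDr !tri_double; lia.
  by lia.
Qed.

(** Consecutive factors of [n (n + 1)] can only be [n] and [n + 1], because
    [a (a + 1)] is strictly increasing in [a]. *)
Lemma consecutive_factors (n a : nat) : (a * (a + 1) = n * (n + 1))%N -> a = n.
Proof.
by move=> E; case: (ltngtP a n) => // lt; have := leq_mul lt (leq_add lt (leqnn 1)); nia.
Qed.

Lemma codivisor_even {n d : nat} :
  odd d -> (d %| n * (n + 1))%N -> ~~ odd ((n * (n + 1)) %/ d)%N.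
Proof.
move=> od /divnK E.
have : ~~ odd (n * (n + 1))%N by rewrite oddM oddD; case: (odd n).
by rewrite -[X in odd X]E oddM od andbT.
Qed.

Lemma gap_odd (n d : nat) :
  admissible n d -> exists k : nat, gap n d = (2 * k + 1)%N%:Z.
Proof.
case=> od dvd _ _; have := codivisor_even od dvd.
rewrite /gap; move: (_ %/ _)%N => e oe.
by exists (`|d%:Z - e%:Z|%N./2); lia.
Qed.

Lemma sum_triangular_gap (n k : nat) : (0 < n)%N ->
  sum_triangular n k <->
  exists2 d, admissible n d & gap n d = (2 * k + 1)%N%:Z.
Proof.
move=> n_gt0; have N0 : (0 < n * (n + 1))%N by nia.
rewrite sum_triangular_factor; split.
- case=> k_gt0 [a Ea].
  have a_gt0 : (0 < a)%N by move: N0; rewrite -Ea; case: (a).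
  (* Of the two factors, the odd one is the divisor sought. *)
  have [oa|ea] := boolP (odd a).
  + exists a; last by rewrite /gap -Ea mulKn //; lia.
    by split=> //; [rewrite -Ea dvdn_mulr | nia | nia].
  + exists (a + 2 * k + 1)%N; last by rewrite /gap -Ea mulnK //; lia.
    by split; [lia | rewrite -Ea dvdn_mull | nia | nia].
- case=> d [od dvd dn dn1]; have /divnK := dvd.
  have := codivisor_even od dvd; rewrite /gap.
  move: (_ %/ _)%N => e oe E g.
  have k_gt0 : (0 < k)%N.
    (* A gap of [1] would make the factors consecutive. *)
    case: k g => // g; have [de|de] : (e = d + 1 \/ d = e + 1)%N by lia.
    + by case: dn; apply: consecutive_factors; rewrite -E de mulnC.
    + by case: dn1; rewrite de (@consecutive_factors n e) // -E de.
  split=> //; have [de|de] : (e = d + 2 * k + 1 \/ d = e + 2 * k + 1)%N by lia.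
  + by exists d; rewrite -E de mulnC.
  + by exists e; rewrite -E -de.
Qed.

Theorem theorem2p3 (n : nat) (hn : (2 <= n)%N) (d e : nat)
  (hd : is_closest n d) (he : e = ((n * (n + 1)) %/ d)%N) :
  (Xi hn)%:R = ((maxn d e)%:R - (minn d e)%:R - 1) / 2%:R :> rat.
Proof.
have n_gt0 : (0 < n)%N by lia.
case: hd => dP dmin; have [k gk] := gap_odd n d dP.
have -> : Xi hn = k.
  rewrite /Xi; case: ex_minnP => x /boolp.asboolP xP xmin.
  apply/eqP; rewrite eqn_leq; apply/andP; split.
    by apply: xmin; apply/boolp.asboolP/sum_triangular_gap => //; exists d.
  have /sum_triangular_gap[//|d' d'P gx] := xP.
  by have := dmin d' d'P; rewrite gk gx; lia.
have -> : maxn d e = (minn d e + 2 * k + 1)%N.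
  by move: gk; rewrite /gap -he; lia.
by rewrite 2!natrD natrM; field.
Qed.
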